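(* Let $n\ge 1$ and let $\{a_{ij}\}_{1\le i,j\le n}$ be a collection of numbers from $[0,1]$. Let $X=\sum_{i=1}^n a_{i\pi(i)}$, where $\pi$ is drawn from the uniform distribution over the set of all permutations of $\{1,\ldots,n\}$. Then for any $t\ge 0$, $$\mathbb{P}\{|X-\mathbb{E}(X)|\ge t\}\le 2\exp\left(-\frac{t^2}{4\,\mathbb{E}(X)+2t}\right).$$
   Context: The numbers $a_{ij}$ are deterministic; the only randomness is in the permutation $\pi$. *)

(* Defs.v *)
From HB Require Import structures.
From mathcomp Require Import all_boot all_order all_algebra all_fingroup.
From mathcomp Require Import all_classical all_reals all_analysis.

Set Implicit Arguments.
Unset Strict Implicit.
Unset Printing Implicit Defensive.

Import Order.TTheory GRing.Theory Num.Theory.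

Local Open Scope classical_set_scope.
Local Open Scope ring_scope.

(* 'S_n is finite, so a map from T into it is a random element (for the
   discrete sigma-algebra) as soon as its fibers are measurable. *)
Definition uniform_permutation (d : measure_display) (T : measurableType d)
    (R : realType) (P : probability T R) (n : nat) (pi : T -> 'S_n) : Prop :=
  forall s : 'S_n,
    measurable (pi @^-1` [set s]) /\
    P (pi @^-1` [set s]) = ((n`!)%:R^-1)%:E.

Definition permutation_sum (T : Type) (R : realType) (n : nat)
    (a : 'I_n -> 'I_n -> R) (pi : T -> 'S_n) : T -> R :=
  fun w => \sum_(i < n) a i (pi w i).

(* Main.v *)
Require Import Defs.
From HB Require Import structures.
From mathcomp Require Import all_boot all_order all_algebra all_fingroup.
From mathcomp Require Import all_classical all_reals all_analysis.
From mathcomp Require Import measurable_realfun ring lra.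

Set Implicit Arguments.
Unset Strict Implicit.
Unset Printing Implicit Defensive.

Import Order.TTheory GRing.Theory Num.Theory.
Import numFieldNormedType.Exports.

Local Open Scope classical_set_scope.
Local Open Scope ring_scope.

(* Chatterjee's exchangeable pair argument.  Composing a permutation [s] with a
   transposition of two uniformly chosen indices gives an exchangeable pair; with
   [X' s] the value of [X] after the swap, [X s - E X] is [n / 2] times the mean of
   [X s - X' s], while the mean of [(X s - X' s) ^+ 2] is at most
   [4 / n * (X s + E X)].  Symmetrizing [E ((X - X') e ^ (u X))] and using
   [(x - y) (e ^ x - e ^ y) <= (x - y) ^ 2 (e ^ x + e ^ y) / 2] turns this into the
   differential inequality [(1 - u) m' u <= 2 (E X) u m u] for the moment generating
   function [m] of [X - E X] (and of its opposite), which is integrated and fed to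
   Chernoff's bound. *)

(** * Exponential inequalities and Chernoff's bound for finite sums *)

Section ExpSums.
Variable R : realType.

(** Convexity: the mean of [expR] over an interval is at most the average of its endpoint values. *)
Lemma expRB_le (x y : R) :
  (x - y) * (expR x - expR y) <= (x - y) ^+ 2 * (expR x + expR y) / 2.
Proof.
wlog le_yx : x y / y <= x => [IH|].
  have [/IH//|/ltW/IH] := leP y x.
  suff -> : (y - x) * (expR y - expR x) = (x - y) * (expR x - expR y).
    by rewrite [expR y + _]addrC -(opprB x y) sqrrN.
  by ring.
(* Dividing by [expR y], it suffices that [h] is nondecreasing on [0, +oo[. *)
pose h (z : R) := z * (expR z + 1) / 2 - expR z.
have dh (z : R) : is_derive z 1 h ((1 - expR z + z * expR z) / 2).
  by apply: is_derive_eq; rewrite /GRing.scale /=; field.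
have h_ge : h 0 <= h (x - y).
  apply: (@ger0_derive1_ndecry _ h 0) => //; last by rewrite subr_ge0.
  (* Multiplying [1 - z <= expR (- z)] by [expR z] shows that the derivative is nonnegative. *)
  - by move=> z _; rewrite derive1E derive_val; have := expR_ge1Dx (- z);
      rewrite expRN => /(ler_wpM2r (expR_ge0 z)); rewrite mulVf ?gt_eqF ?expR_gt0//; lra.
  - by apply: continuous_subspaceT => z; exact/differentiable_continuous/derivable1_diffP.
have -> : expR x = expR (x - y) * expR y by rewrite -expRD subrK.
have : 0 <= (x - y) * expR y by rewrite mulr_ge0 ?expR_ge0 ?subr_ge0.
rewrite /h expR0 mul0r in h_ge.
move: h_ge; set z := x - y; set E := expR z; set F := expR y => h_ge zF.
suff : 0 <= z * F * (z * (E + 1) / 2 - E + 1) by lra.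
by apply: mulr_ge0 => //; lra.
Qed.

Lemma is_derive_sum_expR (I : finType) (f : I -> R) (u : R) :
  is_derive u 1 (fun v => \sum_i expR (v * f i)) (\sum_i f i * expR (u * f i)).
Proof.
elim: (index_enum I) => [|i r IH].
  rewrite big_nil (_ : (fun _ => _) = cst 0); first exact: is_derive_cst.
  by apply/funext => v; rewrite big_nil.
rewrite big_cons (_ : (fun _ => _) =
    (fun v => expR (v * f i)) + (fun v => \sum_(j <- r) expR (v * f j))).
  apply: is_deriveD; apply: is_derive_eq; rewrite /GRing.scale /=; ring.
by apply/funext => v; rewrite big_cons.
Qed.

(** Gronwall's argument: the hypothesis makes the sum times [expR (- (K * v ^+ 2 / 2))]
    nonincreasing on [[0, theta]], and its value at 0 is [#|I|]. *)
Lemma sum_expR_le (I : finType) (f : I -> R) (K theta : R) : 0 <= theta ->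
  (forall u, 0 < u < theta ->
     \sum_i f i * expR (u * f i) <= K * u * \sum_i expR (u * f i)) ->
  \sum_i expR (theta * f i) <= #|I|%:R * expR (K * theta ^+ 2 / 2).
Proof.
move=> theta0 hf.
pose M v := \sum_i expR (v * f i).
pose h v := M v * expR (- (K * v ^+ 2 / 2)).
have dh (v : R) : is_derive v 1 h
    ((\sum_i f i * expR (v * f i) - K * v * M v) * expR (- (K * v ^+ 2 / 2))).
  have dM : is_derive v 1 M (\sum_i f i * expR (v * f i)).
    exact: is_derive_sum_expR.
  by apply: is_derive_eq; rewrite /GRing.scale /=; field.
have : h theta <= h 0.
  apply: (@ler0_derive1_nincr _ h 0 theta) => //.
  - move=> v; rewrite in_itv /= => /hf Hv; rewrite derive1E derive_val.
    by rewrite mulr_le0_ge0 ?expR_ge0// subr_le0.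
  - by apply: continuous_subspaceT => z; exact/differentiable_continuous/derivable1_diffP.
rewrite /h /M expr0n/= mulr0 mul0r oppr0 expR0 mulr1.
under [X in _ <= X]eq_bigr do rewrite mul0r expR0.
rewrite sumr_const expRN -/(_ / _) ler_pdivrMr ?expR_gt0//.
Qed.

Lemma chernoff_count (I : finType) (f : I -> R) (C t : R) : 0 < C -> 0 <= t ->
  (forall u, 0 < u < 1 ->
     (1 - u) * \sum_i f i * expR (u * f i) <= C * u * \sum_i expR (u * f i)) ->
  #|[pred i | t <= f i]|%:R <= #|I|%:R * expR (- (t ^+ 2 / (2 * (C + t)))).
Proof.
(* This choice gives [C / (1 - theta) = C + t], so the final exponent
   [(C + t) * theta ^+ 2 / 2 - theta * t] collapses to [- (t ^+ 2 / (2 * (C + t)))]. *)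
move=> C0 t0 hf; set theta := t / (C + t).
have Ct : 0 < C + t by lra.
have th0 : 0 <= theta by rewrite divr_ge0 // ltW.
have th1 : 1 - theta = C / (C + t) by rewrite /theta; field; rewrite gt_eqF.
have th1p : 0 < 1 - theta by rewrite th1 divr_gt0.
have := @sum_expR_le I f (C / (1 - theta)) theta th0.
have sum0 u : 0 <= \sum_i expR (u * f i) by apply: sumr_ge0 => i _; exact: expR_ge0.
have step u : 0 < u < theta -> \sum_i f i * expR (u * f i) <=
    C / (1 - theta) * u * \sum_i expR (u * f i).
  move=> /andP[u0 ut].
  have /hf : 0 < u < 1 by rewrite u0/=; lra.
  move: (sum0 u); set M := \sum_i expR _; set M' := \sum_i _ => M0 hM.
  (* Replacing [1 - u] by the smaller [1 - theta] needs [M'] positive; otherwise the claim is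
     trivial. *)
  have [M'0|M'0] := leP M' 0.
    by rewrite (le_trans M'0)// !mulr_ge0 ?invr_ge0 // ltW.
  have -> : C / (1 - theta) * u * M = (C * u * M) / (1 - theta) by ring.
  rewrite ler_pdivlMr// (le_trans _ hM)// mulrC ler_pM2r//; lra.
move=> /(_ step) mgf.
have markov : #|[pred i | t <= f i]|%:R * expR (theta * t) <=
    \sum_i expR (theta * f i).
  rewrite -sum1_card natr_sum mulr_suml big_mkcond /=; apply: ler_sum => i _.
  by rewrite inE; case: ifPn => [tf|_]; rewrite ?expR_ge0// mul1r ler_expR ler_wpM2l.
rewrite -(ler_pM2r (expR_gt0 (theta * t))) (le_trans markov)// (le_trans mgf)//.
rewrite -[leRHS]mulrA -expRD ler_wpM2l// ler_expR th1 /theta le_eqVlt; apply/orP; left.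
by apply/eqP; field; rewrite !gt_eqF.
Qed.

End ExpSums.

(** * Exchangeable pairs built from involutions *)

(* The pair [(i, tau j i)] is exchangeable because each [tau j] is an involution. *)
Lemma sum_exchangeable (R : realType) (I J : finType) (tau : J -> I -> I)
    (F : I -> I -> R) : (forall j, involutive (tau j)) ->
  \sum_i \sum_j F i (tau j i) = \sum_i \sum_j F (tau j i) i.
Proof.
move=> tauK; rewrite exchange_big [RHS]exchange_big /=; apply: eq_bigr => j _.
rewrite (reindex_inj (inv_inj (tauK j))).
by apply: eq_bigr => i _; rewrite tauK.
Qed.

(** Exchanging the pair preserves both double sums, so each equals half of its symmetrized form, to
    which [expRB_le] applies termwise. *)
Lemma stein_exchangeable (R : realType) (I J : finType) (tau : J -> I -> I)
    (f : I -> R) (u : R) : (forall j, involutive (tau j)) ->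
  u * (\sum_i \sum_j (f i - f (tau j i)) * expR (u * f i)) <=
  u ^+ 2 / 2 * (\sum_i \sum_j (f i - f (tau j i)) ^+ 2 * expR (u * f i)).
Proof.
move=> tauK.
have E1 := sum_exchangeable (fun x y => (f x - f y) * expR (u * f x)) tauK.
have E2 := sum_exchangeable (fun x y => (f x - f y) ^+ 2 * expR (u * f x)) tauK.
have : \sum_i \sum_j (u * f i - u * f (tau j i)) *
    (expR (u * f i) - expR (u * f (tau j i))) <=
  \sum_i \sum_j (u * f i - u * f (tau j i)) ^+ 2 *
    (expR (u * f i) + expR (u * f (tau j i))) / 2.
  by apply: ler_sum => i _; apply: ler_sum => j _; exact: expRB_le.
move: E1 E2 => /=.
set A := \sum_i _; set A' := \sum_i _; set B := \sum_i _; set B' := \sum_i _.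
move=> EA EB.
have -> : \sum_i \sum_j (u * f i - u * f (tau j i)) *
    (expR (u * f i) - expR (u * f (tau j i))) = u * A + u * A'.
  rewrite !mulr_sumr -big_split; apply: eq_bigr => i _.
  by rewrite !mulr_sumr -big_split; apply: eq_bigr => j _ /=; ring.
have -> : \sum_i \sum_j (u * f i - u * f (tau j i)) ^+ 2 *
    (expR (u * f i) + expR (u * f (tau j i))) / 2 = u ^+ 2 / 2 * B + u ^+ 2 / 2 * B'.
  rewrite !mulr_sumr -big_split; apply: eq_bigr => i _.
  by rewrite !mulr_sumr -big_split; apply: eq_bigr => j _ /=; field.
by rewrite -EA -EB; lra.
Qed.


(** * Moments and tails of the sum over the symmetric group *)

Section PermutationSum.
Variables (R : realType) (n : nat) (a : 'I_n -> 'I_n -> R).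

Local Notation X := (@permutation_sum 'S_n R n a id).

Let total : R := \sum_i \sum_j a i j.
(** Products act left to right, so this exchanges the images of [p.1] and [p.2]. Diagonal pairs are
    kept and fix [s], so sums over [p] have [n ^ 2] terms. *)
Let swap (p : 'I_n * 'I_n) (s : 'S_n) : 'S_n := (tperm p.1 p.2 * s)%g.

Let swapK p : involutive (swap p).
Proof. by move=> s; rewrite /swap mulgA tperm2 mul1g. Qed.

Lemma permutation_sumB_swap i j s :
  X s - X (swap (i, j) s) = a i (s i) + a j (s j) - (a i (s j) + a j (s i)).
Proof.
have [<-|neq_ij] := eqVneq i j.
  by rewrite /swap tperm1 mul1g !subrr.
rewrite /permutation_sum /swap /=.
rewrite (bigD1 i) //= (bigD1 j) 1?eq_sym//= [in X in _ - X](bigD1 i) //=.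
rewrite [in X in _ - X](bigD1 j) 1?eq_sym//= !permM tpermL tpermR.
set S1 := \sum_(k | _) _; set S2 := \sum_(k | _) _.
have -> : S2 = S1.
  by apply: eq_bigr => k /andP[ki kj]; rewrite permM tpermD// eq_sym.
ring.
Qed.

(** These are the entries leaving and entering the sum. Their difference gives the first moment of
    the increment, their sum bounds the second. *)
Lemma sum_swap_entries (s : 'S_n) :
  \sum_i \sum_j (a i (s i) + a j (s j)) = 2 * (n%:R * X s) /\
  \sum_i \sum_j (a i (s j) + a j (s i)) = 2 * total.
Proof.
have tot : \sum_i \sum_j a i (s j) = total.
  by apply: eq_bigr => i _; rewrite [RHS](reindex_inj (@perm_inj _ s)).
split.
- under eq_bigr do rewrite big_split /= sumr_const card_ord.
  rewrite big_split /= sumr_const card_ord sumrMnl -/(X s) /permutation_sum.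
  by rewrite -mulr_natl; ring.
- under eq_bigr do rewrite big_split /=.
  rewrite big_split /= tot exchange_big /= tot; ring.
Qed.

Lemma sum_permutation_sumB_swap s :
  \sum_p (X s - X (swap p s)) = 2 * (n%:R * X s - total).
Proof.
have [E1 E2] := sum_swap_entries s.
rewrite mulrBr -E1 -E2 pair_bigA [X in _ - X]pair_bigA -sumrB.
by apply: eq_bigr => -[i j] _; rewrite permutation_sumB_swap.
Qed.

(** The increment is antisymmetric, so exchangeability makes its total over all [s] and [p] vanish;
    this computes the mean without counting permutations with a prescribed value. *)
Lemma sum_permutation_sum : n%:R * (\sum_s X s) = (n`!)%:R * total.
Proof.
have := sum_exchangeable (fun s s' => X s - X s') swapK.
under [X in _ = X -> _]eq_bigr do under eq_bigr do rewrite -opprB.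
under [X in _ = X -> _]eq_bigr do rewrite sumrN.
rewrite sumrN; under eq_bigr do rewrite sum_permutation_sumB_swap.
rewrite -mulr_sumr sumrB -mulr_sumr sumr_const card_Sn -mulr_natl; lra.
Qed.

Hypotheses (n_gt0 : (0 < n)%N) (a01 : forall i j, 0 <= a i j <= 1).

Let mu : R := (\sum_s X s) / (n`!)%:R.

Let n0 : (0 : R) < n%:R. Proof. by rewrite ltr0n. Qed.

Let fact0 : (0 : R) < (n`!)%:R. Proof. by rewrite ltr0n fact_gt0. Qed.

Let total_mu : total = n%:R * mu.
Proof. by rewrite /mu mulrA sum_permutation_sum mulrAC mulfV ?mul1r ?gt_eqF. Qed.

Lemma permutation_sum_ge0 (s : 'S_n) : 0 <= X s.
Proof. by apply: sumr_ge0 => i _; case/andP: (a01 i (s i)). Qed.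

Let mu_ge0 : 0 <= mu.
Proof.
apply: divr_ge0; last exact: ltW.
by apply: sumr_ge0 => s _; exact: permutation_sum_ge0.
Qed.

Lemma sum_sqr_permutation_sumB_swap s :
  \sum_p (X s - X (swap p s)) ^+ 2 <= 4 * n%:R * (X s + mu).
Proof.
have [E1 E2] := sum_swap_entries s.
have -> : 4 * n%:R * (X s + mu) = \sum_p 2 * (a p.1 (s p.1) + a p.2 (s p.2) +
    (a p.1 (s p.2) + a p.2 (s p.1))).
  rewrite -mulr_sumr big_split /= -(pair_bigA _ (fun i j => a i (s i) + a j (s j))).
  rewrite -(pair_bigA _ (fun i j => a i (s j) + a j (s i))) /= E1 E2 total_mu; ring.
apply: ler_sum => -[i j] _; rewrite permutation_sumB_swap /=.
(* A difference of two numbers in [[0, 2]] is at most 2 and at most their sum in absolute value, so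
   its square is at most twice their sum. *)
move: (a01 i (s i)) (a01 j (s j)) (a01 i (s j)) (a01 j (s i)).
move=> /andP[? ?] /andP[? ?] /andP[? ?] /andP[? ?]; nra.
Qed.

(** Both moments of the increment carry a factor [n], which cancels. A negative [u] will serve the
    lower tail. *)
Lemma stein_permutation_sum u :
  u * (\sum_s (X s - mu) * expR (u * (X s - mu))) <=
  u ^+ 2 * (\sum_s (X s + mu) * expR (u * (X s - mu))).
Proof.
have := stein_exchangeable (fun s => X s - mu) u swapK.
have -> : \sum_s \sum_p (X s - mu - (X (swap p s) - mu)) * expR (u * (X s - mu))
    = 2 * n%:R * \sum_s (X s - mu) * expR (u * (X s - mu)).
  rewrite mulr_sumr; apply: eq_bigr => s _; rewrite -mulr_suml.
  under eq_bigr do rewrite opprB addrA subrK.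
  by rewrite sum_permutation_sumB_swap total_mu; ring.
set S := \sum_s \sum_p _.
have : S <= 4 * n%:R * \sum_s (X s + mu) * expR (u * (X s - mu)).
  rewrite mulr_sumr; apply: ler_sum => s _; rewrite -mulr_suml mulrA.
  rewrite ler_wpM2r ?expR_ge0//.
  by apply: le_trans (sum_sqr_permutation_sumB_swap s); apply: ler_sum => p _; lra.
set A := \sum_s _; set B := \sum_s _ => SB uA.
rewrite -(ler_pM2l n0); have := ler_wpM2l (sqr_ge0 u) SB; lra.
Qed.

Lemma card_permutation_sum_tail (e t : R) : e = 1 \/ e = -1 -> 0 < mu -> 0 <= t ->
  #|[pred s | t <= e * (X s - mu)]|%:R <=
  (n`!)%:R * expR (- (t ^+ 2 / (4 * mu + 2 * t))).
Proof.
move=> e1 mu0 t0.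
(* This is the denominator in [chernoff_count] with [C] equal to [2 * mu]. *)
rewrite (_ : 4 * mu + 2 * t = 2 * (2 * mu + t)); last by ring.
rewrite -card_Sn; apply: chernoff_count => //; first by rewrite mulr_gt0.
move=> u /andP[u0 u1].
have ee : e * e = 1 by case: e1 => ->; ring.
set M' := \sum_s _; set M := \sum_s _.
have M0 : 0 <= M by apply: sumr_ge0 => s _; exact: expR_ge0.
have := stein_permutation_sum (u * e).
have -> : \sum_s (X s - mu) * expR (u * e * (X s - mu)) = e * M'.
  by rewrite mulr_sumr; apply: eq_bigr => s _; rewrite !mulrA ee mul1r.
have -> : \sum_s (X s + mu) * expR (u * e * (X s - mu)) = e * M' + 2 * mu * M.
  rewrite !mulr_sumr -big_split; apply: eq_bigr => s _ /=.
  by rewrite -(mulrA u e) 2!(mulrA e) ee -mulrDl; congr (_ * _); ring.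
have -> : u * e * (e * M') = u * (e * e * M') by ring.
rewrite (_ : (u * e) ^+ 2 * _ = u * (u * (e * e) * (e * M' + 2 * mu * M))); last by ring.
rewrite ler_pM2l// ee mul1r mulr1 => hM.
(* If [M' <= 0], the left side is nonpositive; otherwise [e * M' <= M'] for both signs. *)
have [M'0|M'0] := leP M' 0.
  rewrite (@le_trans _ _ 0)//; first by rewrite mulr_ge0_le0// subr_ge0 ltW.
  by apply: mulr_ge0 => //; apply: mulr_ge0; lra.
have : u * (e * M') <= u * M'.
  by rewrite ler_pM2l//; case: e1 => ->; lra.
lra.
Qed.

Lemma card_permutation_sum_deviation (t : R) : 0 <= t ->
  #|[pred s | t <= `|X s - mu|]|%:R / (n`!)%:R <=
  2 * expR (- (t ^+ 2 / (4 * mu + 2 * t))).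
Proof.
move=> t0; rewrite ler_pdivrMr//.
(* Chernoff's bound needs [0 < mu]. If [mu = 0], then [X] vanishes identically: the event is empty
   for [t > 0], while at [t = 0] the exponent [0 / 0] is 0 and the bound is 2. *)
have [mu0|mu0] := ltP 0 mu; last first.
  have muE : mu = 0 by apply/eqP; rewrite eq_le mu0.
  have X0 s : X s = 0.
    have S0 : \sum_s X s = 0.
      by apply/eqP; move/eqP: muE; rewrite /mu mulf_eq0 invr_eq0 (gt_eqF fact0) orbF.
    exact: (psumr_eq0P (fun s _ => permutation_sum_ge0 s) S0).
  have [->|tn0] := eqVneq t 0.
    rewrite expr0n/= mul0r oppr0 expR0 mulr1.
    by rewrite (@le_trans _ _ (n`!)%:R)// ?ler_peMl// ?ler1n// -card_Sn ler_nat max_card.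
  rewrite (@eq_card0 _ [pred _ | _]) ?mulr_ge0 ?expR_ge0//.
  by move=> s; rewrite inE X0 muE subrr normr0 leNgt lt_neqAle eq_sym tn0 t0.
apply: (@le_trans _ _ (#|[pred s | t <= 1 * (X s - mu)]|%:R +
    #|[pred s | t <= -1 * (X s - mu)]|%:R)).
  rewrite -natrD ler_nat -cardUI (leq_trans _ (leq_addr _ _))//.
  by apply/subset_leq_card/fintype.subsetP => s; rewrite !inE mul1r mulN1r ler_normr.
have := @card_permutation_sum_tail 1 t (or_introl erefl) mu0 t0.
have := @card_permutation_sum_tail (-1) t (or_intror erefl) mu0 t0.
lra.
Qed.

End PermutationSum.

(** * Transfer from the probability space to counting permutations *)

Section UniformPermutation.
Variables (R : realType) (d : measure_display) (T : measurableType d).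
Variables (P : probability T R) (n : nat) (pi : T -> 'S_n).
Hypothesis (pi_unif : uniform_permutation P pi).

(** The event is a finite disjoint union of fibers of [pi], each measurable of known mass. *)
Lemma uniform_permutation_prob (Q : pred 'S_n) :
  P [set w | Q (pi w)] = (#|Q|%:R / (n`!)%:R)%:E.
Proof.
have -> : [set w | Q (pi w)] = \bigcup_(s in [set` enum Q]) (pi @^-1` [set s]).
  apply/seteqP; split => [w Qw|w [s /=]]; first by exists (pi w); rewrite //= mem_enum.
  by rewrite mem_enum => Qs /= ->.
rewrite measure_fin_bigcup//; last 2 first.
- by move=> s s' _ _ [w [<-]].
- by move=> s _; case: (pi_unif s).
rewrite -fsbig_seq ?enum_uniq// (eq_bigr (fun=> ((n`!)%:R^-1)%:E)); last first.
  by move=> s _; case: (pi_unif s).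
by rewrite sumEFin big_enum sumr_const mulr_natl.
Qed.

(** The integrand is a finite combination of indicators of fibers; nonnegativity lets the integral
    pass through the sum without an integrability proof. *)
Lemma uniform_permutation_expectation (g : 'S_n -> R) : (forall s, 0 <= g s) ->
  ('E_P[fun w => g (pi w)] = ((\sum_s g s) / (n`!)%:R)%:E)%E.
Proof.
move=> g0; rewrite unlock.
have -> : (fun w => (g (pi w))%:E) =
    (fun w => \sum_s ((g s)%:E * (\1_(pi @^-1` [set s]) w)%:E)%E).
  apply/funext => w; rewrite (bigD1 (pi w)) //= indicE mem_set// mule1.
  rewrite big1 ?adde0// => s /eqP ne; rewrite indicE memNset ?mule0//.
  by move=> /= /esym.
have mpi s : measurable (pi @^-1` [set s]) by case: (pi_unif s).
rewrite ge0_integral_sum//; last 2 first.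
- by move=> s; apply: measurable_funeM; apply/measurable_EFinP; exact: measurable_indic.
- by move=> s w _; rewrite mule_ge0 ?lee_fin.
rewrite mulr_suml -sumEFin; apply: eq_bigr => s _.
rewrite ge0_integralZl ?lee_fin//.
  by rewrite integral_indic// classical_sets.setIT EFinM; congr (_ * _)%E; exact: (pi_unif s).2.
by apply/measurable_EFinP; exact: measurable_indic.
Qed.

End UniformPermutation.

Theorem proposition1p1 (R : realType) (d : measure_display)
    (T : measurableType d) (P : probability T R)
    (n : nat) (hn : (1 <= n)%N)
    (a : 'I_n -> 'I_n -> R) (ha : forall i j, 0 <= a i j <= 1)
    (pi : T -> 'S_n) (hpi : uniform_permutation P pi)
    (t : R) (ht : 0 <= t) :
  let X := permutation_sum a pi in
  let EX := fine ('E_P[X])%E in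
  (P [set w | (t <= `|X w - EX|)%R] <=
     (2 * expR (- (t ^+ 2 / (4 * EX + 2 * t))))%R%:E)%E.
Proof.
cbv zeta.
have -> : fine ('E_P[permutation_sum a pi])%E = (\sum_s permutation_sum a id s) / (n`!)%:R.
  rewrite (uniform_permutation_expectation hpi (g := permutation_sum a id))//.
  exact: permutation_sum_ge0.
set mu := _ / _.
rewrite (uniform_permutation_prob hpi [pred s | t <= `|permutation_sum a id s - mu|]).
by rewrite lee_fin; exact: card_permutation_sum_deviation.
Qed.
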